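(* For each $n \in \mathbb{N}$, it holds that $$\mathsf{L}_{\mathsf{d}_{\mathcal{C}}}(u_n)=2^{n+1}=\mathsf{L}^{\lambda}_{\mathcal{T}_{\mathcal{C}}}(u_n).$$ And, for each $z \in \mathbb{N}\setminus\{0\}$ and $j_0,\ldots,j_z \in \mathbb{N}$ such that $j_0<\cdots<j_z$, it holds that $$\mathsf{L}_{\mathsf{d}_{\mathcal{C}}}(u_{j_0}\cdots u_{j_z})=2^{j_z+1}=\mathsf{L}^{\lambda}_{\mathcal{T}_{\mathcal{C}}}(u_{j_0}\cdots u_{j_z}).$$
   Context: Convention: $\mathbb{N}$ contains $0$. The Cantor space is $\mathcal{C}=\{(x_n)_{n\in\mathbb{N}} : x_n\in\{0,1\} \text{ for all } n\}$ with the metric $\mathsf{d}_{\mathcal{C}}(x,y)=0$ if $x=y$ and $\mathsf{d}_{\mathcal{C}}(x,y)=2^{-\min\{m\in\mathbb{N} : x_m\neq y_m\}}$ otherwise. $C(\mathcal{C})$ is the C*-algebra of continuous functions $\mathcal{C}\to\mathbb{C}$ with pointwise operations, supremum norm $\|\cdot\|_\infty$ and unit $1_{C(\mathcal{C})}$ (the constant function $1$). For $n\in\mathbb{N}$, $\eta_n\in C(\mathcal{C})$ is the coordinate map $\eta_n((z_m)_{m\in\mathbb{N}})=z_n$, and $u_n=2\eta_n-1_{C(\mathcal{C})}$ (so $u_n$ takes values in $\{-1,1\}$). Set $B_0=\emptyset$ and, for $n\geq 1$, $B_n=\{\prod_{j\in F}u_j : \emptyset\neq F\subseteq\{0,\ldots,n-1\}\}$.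 For $n \in \mathbb{N}$ set $B_n'=\{1_{C(\mathcal{C})}\}\cup B_n$ and $A_n=\operatorname{span}_{\mathbb{C}} B_n'$. $\lambda$ is the state on $C(\mathcal{C})$ (unital norm-one continuous linear functional) determined by $\lambda\left(\prod_{j\in F}u_j\right)=0$ for every nonempty finite $F\subset\mathbb{N}$; it is integration against the product of the uniform probability measures on $\{0,1\}$. For $n\in\mathbb{N}$, $E_n:C(\mathcal{C})\to A_n$ is $E_n(f)=\sum_{a\in B_n'}\lambda(fa)\,a$. The two seminorms (with values in $[0,\infty]$) are, for $f\in C(\mathcal{C})$, $$\mathsf{L}_{\mathsf{d}_{\mathcal{C}}}(f)=\sup_{x,y\in\mathcal{C},\,x\neq y}\frac{|f(x)-f(y)|}{\mathsf{d}_{\mathcal{C}}(x,y)},\qquad \mathsf{L}^{\lambda}_{\mathcal{T}_{\mathcal{C}}}(f)=\sup_{n\in\mathbb{N}}\frac{\|f-E_n(f)\|_\infty}{2^{-(n+1)}}.$$ *)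

(* Defs.v *)
From HB Require Import structures.
From mathcomp Require Import all_boot all_order all_algebra finmap.
From mathcomp Require Import all_classical all_reals all_analysis.
From mathcomp Require Import complex.

Set Implicit Arguments.
Unset Strict Implicit.
Unset Printing Implicit Defensive.

Import Order.TTheory GRing.Theory Num.Theory.
Import numFieldNormedType.Exports.
Import ComplexField.Normc.

Local Open Scope classical_set_scope.
Local Open Scope ring_scope.

(* The library puts the norm topology on the carrier of any [numFieldType];
   naming C as a [numFieldType] makes that topology available on it. *)
Definition CC (R : realType) : numFieldType := (R[i])%C.

Definition contC (R : realType) : Type := continuousType cantor_space (CC R).

(* C(cantor_space) as a subalgebra of the pointwise algebra of all functions. *)
Section Algebra.
Context (R : realType).

Definition contC_fun (f : contC R) : cantor_space -> CC R := Continuous.sort f.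
Coercion contC_fun : contC >-> Funclass.

Lemma contC_continuous (f : contC R) : continuous f.
Proof. exact: cts_fun. Qed.

Definition contC_pred : {pred cantor_space -> CC R} :=
  mem [set f : cantor_space -> CC R | continuous f].

Lemma contC_predP (f : cantor_space -> CC R) :
  reflect (continuous f) (f \in contC_pred).
Proof. by apply: (iffP idP); rewrite inE. Qed.

Definition mkcontC (f : cantor_space -> CC R) (cf : continuous f) : contC R :=
  (mkcts cf : continuousType cantor_space (CC R)).

Definition contC_Sub f (fP : f \in contC_pred) : contC R :=
  mkcontC (elimT (contC_predP f) fP).

Fact contC_rect (P : contC R -> Type) :
  (forall f (Pf : f \in contC_pred), P (contC_Sub Pf)) -> forall f, P f.
Proof.
move=> PSub f.
have fP : contC_fun f \in contC_pred.
  by apply/contC_predP; exact: contC_continuous.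
by rewrite (_ : f = contC_Sub fP) //; apply/continuousEP.
Qed.

Fact contC_valP f (Pf : f \in contC_pred) : contC_fun (contC_Sub Pf) = f.
Proof. by []. Qed.

HB.instance Definition _ :=
  isSub.Build (cantor_space -> CC R) contC_pred (contC R) contC_rect contC_valP.
HB.instance Definition _ := [Choice of contC R by <:].

Fact contC_subring_closed : subring_closed contC_pred.
Proof.
split=> [|f g /contC_predP cf /contC_predP cg|f g /contC_predP cf /contC_predP cg];
  apply/contC_predP => x.
- exact: cst_continuous.
- by apply: (@continuousB _ (CC R)^o); [exact: cf|exact: cg].
- by apply: continuousM; [exact: cf|exact: cg].
Qed.

Fact contC_scaler_closed : scaler_closed contC_pred.
Proof.
move=> a f /contC_predP cf; apply/contC_predP => x.
by apply: (@continuousZr _ (CC R)^o); exact: cf.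
Qed.

HB.instance Definition _ :=
  GRing.isSubringClosed.Build (cantor_space -> CC R) contC_pred
    contC_subring_closed.
HB.instance Definition _ :=
  GRing.isScaleClosed.Build (CC R) (cantor_space -> CC R) contC_pred
    contC_scaler_closed.
HB.instance Definition _ := [SubChoice_isSubComNzRing of contC R by <:].
HB.instance Definition _ := [SubZmodule_isSubLmodule of contC R by <:].

Lemma contCE (f g : contC R) (a : CC R) (x : cantor_space) :
  [/\ (0 : contC R) x = 0, (1 : contC R) x = 1, (f + g : contC R) x = f x + g x,
      (- f : contC R) x = - f x &
      (f * g : contC R) x = f x * g x /\ (a *: f : contC R) x = a * f x].
Proof. by []. Qed.

Lemma contC_prod I (r : seq I) (P : pred I) (f : I -> contC R) x :
  (\prod_(i <- r | P i) f i : contC R) x = \prod_(i <- r | P i) f i x.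
Proof. by elim/big_rec2: _ => //= i y ? Pi <-. Qed.

End Algebra.
Arguments contC_fun {R} f : simpl never.

Section Cantor.
Context (R : realType).

Lemma cantor_neq_ex (x y : cantor_space) :
  x <> y -> exists m : nat, x m != y m.
Proof.
move=> xy; apply: contrapT => /forallNP xyE; apply: xy; apply/funext => m.
by apply/eqP/negPn/negP/xyE.
Qed.

Definition cantor_dist (x y : cantor_space) : R :=
  match pselect (x = y) with
  | left _ => 0
  | right xy => 2 ^- ex_minn (cantor_neq_ex xy)
  end.

(* The product topology of [cantor_space] is the topology of [cantor_dist]. *)
Lemma cantor_dist_nbhsE (x : cantor_space) (A : set cantor_space) :
  nbhs x A <->
  exists2 e : R, 0 < e & forall y, cantor_dist x y < e -> A y.
Proof.
split.
- move=> xA.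
  have [n nA] : exists n : nat, forall y : cantor_space,
      (forall m, (m < n)%N -> y m = x m) -> A y.
    apply: contrapT => /forallNP nA.
    have {}nA n : exists y : cantor_space,
        (forall m, (m < n)%N -> y m = x m) /\ ~ A y.
      by have /existsNP[y /not_implyP yP] := nA n; exists y.
    have [y yP] := choice nA.
    have yx : y @ \oo --> x.
      apply/(@pointwise_cvgP nat bool) => i C nC; exists i.+1 => // k /= ik.
      by rewrite /= (yP k).1 //; exact: nbhs_singleton nC.
    have [k _ kA] := yx _ xA.
    by apply: (yP k).2; apply: kA => /=.
  exists (2 ^- n); first by rewrite invr_gt0 exprn_gt0.
  move=> y; rewrite /cantor_dist; case: pselect => [<- _|xy].
    exact: nA.
  case: ex_minnP => m xym mP; rewrite ltf_pV2 ?posrE ?exprn_gt0 //.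
  rewrite ltr_eXn2l ?ltr1n // => nm; apply: nA => k kn.
  by apply/esym/eqP/negPn/negP => /mP; rewrite leqNgt (ltn_trans kn nm).
- move=> [e e0 eA].
  have [n ne] : exists n : nat, 2 ^- n < e.
    exists (Num.bound e^-1); rewrite invf_plt ?posrE ?exprn_gt0 //.
    exact: upper_nthrootP.
  have : nbhs x (\bigcap_(m in [set` [fset i | i in iota 0 n]%fset])
      [set y : cantor_space | y m = x m]).
    apply: filter_bigI => m _.
    apply: (@proj_continuous _ _ m x [set x m]).
    exact: discrete_set1.
  apply: filterS => y yx; apply: eA; apply: le_lt_trans ne.
  rewrite /cantor_dist; case: pselect => [_|xy]; first by rewrite invr_ge0 exprn_ge0.
  case: ex_minnP => m xym _; rewrite lef_pV2 ?posrE ?exprn_gt0 //.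
  rewrite ler_eXn2l ?ltr1n // leqNgt; apply/negP => mn.
  by move: xym; rewrite (yx m) ?eqxx //= in_fset mem_iota.
Qed.

Definition supnorm (f : contC R) : R :=
  sup [set normc (f x) | x in [set: cantor_space]].

Definition lip_dist (f : contC R) : \bar R :=
  ereal_sup [set r | exists x y : cantor_space,
    x <> y /\ r = (normc (f x - f y) / cantor_dist x y)%:E].

Definition eta_fun (n : nat) (z : cantor_space) : CC R := (z n)%:R.

Fact eta_continuous n : continuous (eta_fun n).
Proof.
move=> z; apply: (@continuous_comp _ _ _ (fun z : cantor_space => z n)
  (fun b : bool => b%:R : CC R)).
- exact: proj_continuous.
- move=> A nA; apply: (filterS _ (@discrete_set1 bool (z n))) => b /= ->.
  exact: nbhs_singleton nA.
Qed.

Definition eta_ (n : nat) : contC R := mkcontC (@eta_continuous n).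

Definition u_ (n : nat) : contC R := 2 *: eta_ n - 1.

Definition B_ (n : nat) : set (contC R) :=
  [set a | exists F : {fset nat},
    [/\ F != fset0, forall j, j \in F -> (j < n)%N & a = \prod_(j <- F) u_ j]].

Definition B'_ (n : nat) : set (contC R) := 1 |` B_ n.

Record is_state (lambda : {scalar contC R}) : Prop := {
  state_unital : lambda 1 = 1;
  state_norm1 : ereal_sup [set (normc (lambda f))%:E
                          | f in [set f | supnorm f <= 1]] = 1%E }.

(* These two conditions determine [lambda]: the span of the products below and
   of 1 is dense. Existence is [uniform_state_exists]. *)
Definition is_uniform_state (lambda : {scalar contC R}) : Prop :=
  is_state lambda /\
  forall F : {fset nat}, F != fset0 -> lambda (\prod_(j <- F) u_ j) = 0.

(* [B'_ n] is finite, so these sums over a set are genuine finite sums. *)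
Definition A_ (n : nat) : set (contC R) :=
  [set f | exists c : contC R -> CC R, f = \sum_(a \in B'_ n) c a *: a].

Definition E_ (lambda : {scalar contC R}) (n : nat) (f : contC R) : contC R :=
  \sum_(a \in B'_ n) lambda (f * a) *: a.

Lemma E_A lambda n f : A_ n (E_ lambda n f).
Proof. by exists (fun a => lambda (f * a)). Qed.

Definition lip_filtration (lambda : {scalar contC R}) (f : contC R) : \bar R :=
  ereal_sup [set (supnorm (f - E_ lambda n f) / 2 ^- (n + 1))%:E
            | n in [set: nat]].

End Cantor.

Section ExistsUniformState.
Context (R : realType).

Lemma normCC (z : CC R) : `|z| = ((normc z)%:C)%C :> R[i].
Proof. by []. Qed.

Lemma normc_continuous (f : contC R) : continuous (fun x => normc (f x) : R).
Proof.
move=> x; apply/cvgrPdist_lt => e e0.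
have eC : 0 < (e%:C)%C :> CC R by rewrite ltcR.
have /cvgrPdist_lt/(_ _ eC) : f y @[y --> x] --> (f x : (CC R)^o).
  exact: contC_continuous.
apply: filterS => y; rewrite normCC ltcR; apply: le_lt_trans.
have tri (a b : R[i]) : normc a - normc b <= normc (a - b).
  by rewrite lerBlDr; have := le_normcD (a - b) b; rewrite subrK.
rewrite ler_norml tri andbT lerNl opprB.
by apply: le_trans (tri _ _) _; rewrite -normcN opprB.
Qed.

Lemma supnorm_has_ubound (f : contC R) :
  has_ubound [set normc (f x) | x in [set: cantor_space]].
Proof.
have : bounded_set [set normc (f x) | x in [set: cantor_space]].
  apply: compact_bounded; apply: continuous_compact.
    by apply: continuous_subspaceT; exact: normc_continuous.
  exact: cantor_space_compact.
move=> [M [_ /(_ (M + 1))]]; rewrite ltrDl ltr01 => /(_ isT) fM.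
by exists (M + 1) => r fr; apply: le_trans (fM r fr); exact: ler_norm.
Qed.

Lemma normc_supnorm (f : contC R) x : normc (f x) <= supnorm f.
Proof. by apply: ub_le_sup; [exact: supnorm_has_ubound|exists x]. Qed.

Lemma supnorm1 : supnorm (1 : contC R) = 1.
Proof.
rewrite /supnorm (_ : [set _ | _ in _] = [set 1]) ?sup1 // eqEsubset.
split=> [_ [x _ <-]|_ ->]; first exact: normc1.
by exists (fun=> true) => //; exact: normc1.
Qed.

Definition cantor_ext n (x : {ffun 'I_n -> bool}) : cantor_space :=
  fun k => if insub k is Some i then x i else false.

Definition cantor_avg n (f : contC R) : CC R :=
  (2 ^+ n)^-1 * \sum_(x : {ffun 'I_n -> bool}) f (cantor_ext x).

Lemma avg_linear n a (f g : contC R) : cantor_avg n (a *: f + g) =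
  a * cantor_avg n f + cantor_avg n g.
Proof.
rewrite /cantor_avg (eq_bigr (fun x => a * f (cantor_ext x) + g (cantor_ext x))) //.
by rewrite big_split /= -mulr_sumr mulrDr mulrCA.
Qed.

Lemma avg1 n : cantor_avg n 1 = 1.
Proof.
rewrite /cantor_avg (eq_bigr (fun=> 1)) // sumr_const card_ffun card_bool card_ord.
by rewrite natrX mulVf // expf_neq0 // pnatr_eq0.
Qed.

Lemma avg_le n (f : contC R) : normc (cantor_avg n f) <= supnorm f.
Proof.
rewrite -lecR -normCC /cantor_avg normrM normfV normrX normr_nat.
rewrite mulrC ler_pdivrMr ?exprn_gt0 //.
apply: le_trans (ler_norm_sum _ _ _) _.
apply: (@le_trans _ _ (\sum_(x : {ffun 'I_n -> bool}) ((supnorm f)%:C)%C)).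
  by apply: ler_sum => x _; rewrite normCC lecR; exact: normc_supnorm.
by rewrite sumr_const card_ffun card_bool card_ord -[leLHS]mulr_natr natrX.
Qed.

Lemma u_E n x : u_ R n x = if x n then 1 else -1.
Proof.
rewrite /u_ /= (_ : _ x = 2 * (x n)%:R - 1) //.
by case: (x n); rewrite ?mulr1 ?mulr0 ?sub0r // mulr2n addrK.
Qed.

Lemma avg_prod n (F : {fset nat}) j : j \in F -> (j < n)%N ->
  cantor_avg n (\prod_(j <- F) u_ R j) = 0.
Proof.
move=> jF jn; rewrite /cantor_avg; set S := \sum_(x : _) _.
suff : S = - S.
  move/eqP; rewrite -addr_eq0 -mulr2n mulrn_eq0 /= => /eqP ->.
  by rewrite mulr0.
pose h (x : {ffun 'I_n -> bool}) := [ffun i => x i (+) (i == Ordinal jn)].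
have hK : involutive h.
  by move=> x; apply/ffunP => i; rewrite !ffunE -addbA addbb addbF.
rewrite {1}/S (reindex_inj (inv_inj hK)) /= -sumrN; apply: eq_bigr => x _.
rewrite !contC_prod !(big_fsetD1 j jF) /= -mulNr; congr (_ * _).
  rewrite !u_E /cantor_ext; case: insubP => [i _ ij|]; last by rewrite jn.
  rewrite ffunE (_ : i == _); last by apply/eqP/val_inj; rewrite /= ij.
  by case: (x i); rewrite /= ?opprK.
apply: eq_big_seq => i; rewrite !inE => /andP[ij _].
rewrite !u_E /cantor_ext; case: insubP => // k _ ki.
by rewrite ffunE (_ : (k == _) = false) ?addbF // -val_eqE /= ki (negbTE ij).
Qed.

Lemma ultra_cvg (U : set_system nat) (r : nat -> R) (M : R) :
  UltraFilter U -> (forall n, `|r n| <= M) -> r @ U --> lim (r @ U).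
Proof.
move=> ultraU rM; suff [c rc] : exists c : R, r @ U --> c.
  exact: (@cvgP _ _ c rc).
have PU : ProperFilter U by exact: ultra_proper.
have [] := @segment_compact R (- M) M (r @ U) (fmap_proper_filter r PU).
  apply: (@filterE nat U) => n.
  by rewrite /preimage /= in_itv /= -ler_norml.
move=> c [_ cc]; exists c => V cV.
have [//|UV] := in_ultra_setVsetC (r @^-1` V) ultraU.
have [x [/= nVx]] := cc (~` V) V UV cV.
by [].
Qed.

Lemma normc_Re (z : R[i]) : `|complex.Re z| <= normc z.
Proof.
by case: z => p q /=; rewrite -sqrtr_sqr ler_sqrt ?lerDl ?sqr_ge0 ?addr_ge0 ?sqr_ge0.
Qed.

Lemma normc_Im (z : R[i]) : `|complex.Im z| <= normc z.
Proof.
by case: z => p q /=; rewrite -sqrtr_sqr ler_sqrt ?lerDr ?sqr_ge0 ?addr_ge0 ?sqr_ge0.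
Qed.

Lemma uniform_state_exists :
  exists lambda : {scalar contC R}, is_uniform_state lambda.
Proof.
have [U [ultraU ooU]] := @ultraFilterLemma nat \oo _.
pose re (f : contC R) n : R := complex.Re (cantor_avg n f : R[i]).
pose im (f : contC R) n : R := complex.Im (cantor_avg n f : R[i]).
have rec f : re f @ U --> lim (re f @ U).
  apply: (@ultra_cvg _ _ (supnorm f)) => n.
  exact: le_trans (normc_Re _) (avg_le n f).
have imc f : im f @ U --> lim (im f @ U).
  apply: (@ultra_cvg _ _ (supnorm f)) => n.
  exact: le_trans (normc_Im _) (avg_le n f).
pose lam (f : contC R) : CC R := (lim (re f @ U) +i* lim (im f @ U))%C.
have limE (r : nat -> R) (l : R) : r @ U --> l -> lim (r @ U) = l.
  exact: cvg_lim.
have lam_lin : linear_for *%R lam.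
  move=> a f g; rewrite /lam.
  have reE : re (a *: f + g) = (fun n => complex.Re (a : R[i]) * re f n
      - complex.Im (a : R[i]) * im f n + re g n).
    apply/funext => n; rewrite /re /im avg_linear.
    by case: a (cantor_avg n f) (cantor_avg n g) => [a1 a2] [? ?] [? ?].
  have imE : im (a *: f + g) = (fun n => complex.Re (a : R[i]) * im f n
      + complex.Im (a : R[i]) * re f n + im g n).
    apply/funext => n; rewrite /re /im avg_linear.
    by clear reE; case: a (cantor_avg n f) (cantor_avg n g) => [a1 a2] [? ?] [? ?].
  have limre : lim (re (a *: f + g) @ U) = complex.Re (a : R[i]) * lim (re f @ U)
      - complex.Im (a : R[i]) * lim (im f @ U) + lim (re g @ U).
    apply: limE; rewrite reE.
    exact: (cvgD (cvgB (cvgM (cvg_cst _) (rec f)) (cvgM (cvg_cst _) (imc f)))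
      (rec g)).
  have limim : lim (im (a *: f + g) @ U) = complex.Re (a : R[i]) * lim (im f @ U)
      + complex.Im (a : R[i]) * lim (re f @ U) + lim (im g @ U).
    apply: limE; rewrite imE.
    exact: (cvgD (cvgD (cvgM (cvg_cst _) (imc f)) (cvgM (cvg_cst _) (rec f)))
      (imc g)).
  rewrite limre limim; clear reE imE limre limim.
  by case: a => a1 a2.
pose lamL := GRing.isLinear.Build (CC R) (contC R) (CC R) *%R lam lam_lin.
pose lambda : {scalar contC R} := HB.pack lam lamL.
have lam1 : lambda 1 = 1.
  rewrite /lambda /= /lam (limE _ 1) ?(limE _ 0) //.
  - by rewrite /im (_ : (fun _ => _) = cst 0) ?funeqE => [|n]; [exact: cvg_cst|rewrite avg1].
  - by rewrite /re (_ : (fun _ => _) = cst 1) ?funeqE => [|n]; [exact: cvg_cst|rewrite avg1].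
have lam_le f : normc (lambda f) <= supnorm f.
  have s0 : 0 <= supnorm f.
    exact: le_trans (normr_ge0 _) (le_trans (normc_Re _) (normc_supnorm f point)).
  rewrite /lambda /= /lam -[leRHS]ger0_norm // -sqrtr_sqr ler_sqrt ?sqr_ge0 //.
  have c2 : (fun n => re f n ^+ 2 + im f n ^+ 2) @ U -->
      lim (re f @ U) ^+ 2 + lim (im f @ U) ^+ 2.
    by apply: cvgD; apply: cvgM.
  rewrite -(limE _ _ c2); apply: limr_le; first exact: cvgP c2.
  apply: filterE => n; have := avg_le n f; rewrite /re /im.
  case: (cantor_avg n f) => p q /= pq.
  rewrite -[leLHS]sqr_sqrtr ?addr_ge0 ?sqr_ge0 //.
  by rewrite ler_sqr ?nnegrE ?sqrtr_ge0.
exists lambda; split.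
  split=> //; apply/eqP; rewrite eq_le; apply/andP; split.
    apply: ge_ereal_sup => _ [f f1 <-]; rewrite lee_fin.
    exact: le_trans (lam_le f) f1.
  apply: ereal_sup_ubound; exists 1; first by rewrite /= supnorm1.
  by rewrite lam1 normc1.
move=> F /fset0Pn[j jF].
have F0 n : (j < n)%N -> cantor_avg n (\prod_(j <- F) u_ R j) = 0 by exact: avg_prod.
have nearU : \forall n \near U, (j < n)%N by apply: ooU; exists j.+1.
rewrite /lambda /= /lam (limE _ 0) ?(limE _ 0) //.
- by apply: cvg_near_cst; apply: filterS nearU => n jn; rewrite /im F0.
- by apply: cvg_near_cst; apply: filterS nearU => n jn; rewrite /re F0.
Qed.

End ExistsUniformState.

(* Main.v *)
(** The Walsh functions [walsh F], products of the [u_ j] over a finite set F,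
    take values in {1, -1}, multiply by symmetric difference of the index sets,
    and are therefore orthonormal for [lambda]. Hence, with m the largest element
    of F, E_n maps [walsh F] to itself when m < n and to 0 otherwise, so the
    quotient defining the filtration seminorm is 2^(n+1) for n <= m and 0 after.
    Metrically, [walsh F] depends only on the coordinates up to m, oscillates by
    at most 2, and flips sign with the coordinate m. *)
Require Import Defs.
From mathcomp Require Import all_boot all_order all_algebra finmap.
From mathcomp Require Import all_classical all_reals all_analysis.
From mathcomp Require Import complex.

Import Order.TTheory GRing.Theory Num.Theory.
Import ComplexField.Normc.
Local Open Scope ring_scope.

Definition walsh (R : realType) (F : {fset nat}) : contC R :=
  \prod_(j <- F) u_ R j.

Lemma u_sqr (R : realType) (n : nat) : u_ R n * u_ R n = 1.
Proof.
apply/val_inj/funext => x /=.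
have [_ -> _ _ [-> _]] := contCE (u_ R n) (u_ R n) 0 x.
by rewrite u_E; case: (x n); rewrite ?mulrNN mulr1.
Qed.

Lemma walsh_sqr (R : realType) (F : {fset nat}) : walsh R F * walsh R F = 1.
Proof.
by rewrite /walsh -big_split /= big1 // => j _; exact: u_sqr.
Qed.

Lemma walsh_mul (R : realType) (F G : {fset nat}) :
  walsh R F * walsh R G = walsh R ((F `\` G) `|` (G `\` F))%fset.
Proof.
have walshID (A B : {fset nat}) :
    walsh R A = walsh R (A `&` B)%fset * walsh R (A `\` B)%fset.
  rewrite /walsh (big_fsetID _ (mem B)) /=.
  congr (_ * _); apply: eq_fbigl => j; rewrite !inE /= ?andbT //.
  by rewrite andbC.
rewrite (walshID F G) (walshID G F) fsetIC mulrACA walsh_sqr mul1r.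
rewrite /walsh -big_cat /=; apply/perm_big/uniq_perm => [| |j].
- rewrite cat_uniq !fset_uniq andbT /=; apply/hasPn => j /=.
  by rewrite !inE => /andP[/negbTE ->]; rewrite andbF.
- exact: fset_uniq.
- by rewrite mem_cat !inE.
Qed.

Lemma walsh_orthogonal (R : realType) (lambda : {scalar contC R}) (F G : {fset nat}) :
  is_uniform_state lambda -> F != G -> lambda (walsh R F * walsh R G) = 0.
Proof.
move=> [_ lambda0] FG; rewrite walsh_mul; apply: lambda0.
apply: contraNneq FG => /eqP; rewrite fsetU_eq0 !fsetD_eq0 => FG.
by rewrite eqEfsubset.
Qed.

Lemma walsh0 (R : realType) : walsh R fset0 = 1.
Proof. by rewrite /walsh big_seq_fset0. Qed.

Lemma B'_walsh (R : realType) (n : nat) (a : contC R) :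
  B'_ n a <-> exists2 G : {fset nat},
    (forall j, j \in G -> (j < n)%N) & a = walsh R G.
Proof.
split=> [[->|[G [_ Gn ->]]]|[G Gn ->]]; [|by exists G|].
  by exists fset0; rewrite ?walsh0.
have [->|G0] := eqVneq G fset0; first by left; rewrite walsh0.
by right; exists G.
Qed.

Lemma E_walsh_id (R : realType) (lambda : {scalar contC R}) (n : nat) (F : {fset nat}) :
  is_uniform_state lambda -> (forall j, j \in F -> (j < n)%N) ->
  E_ lambda n (walsh R F) = walsh R F.
Proof.
move=> hl Fn; rewrite /E_ -(@fsbig_widen _ _ _ _ [set walsh R F]%classic).
- by rewrite fsbig_set1 walsh_sqr (state_unital hl.1) scale1r.
- by move=> a ->; apply/B'_walsh; exists F.
- move=> a [/B'_walsh[G _ ->] GF] /=.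
  rewrite walsh_orthogonal ?scale0r //.
  by apply: contra_not_neq GF => ->.
Qed.

Lemma E_walsh_eq0 (R : realType) (lambda : {scalar contC R}) (n m : nat) (F : {fset nat}) :
  is_uniform_state lambda -> m \in F -> (n <= m)%N ->
  E_ lambda n (walsh R F) = 0.
Proof.
move=> hl mF nm; rewrite /E_ fsbig1 // => a /B'_walsh[G Gn ->].
rewrite walsh_orthogonal ?scale0r //.
by apply: contraTneq mF => ->; apply/negP => /Gn; rewrite ltnNge nm.
Qed.

Lemma walsh_pm1 (R : realType) (F : {fset nat}) (x : cantor_space) :
  walsh R F x = 1 \/ walsh R F x = -1.
Proof.
have := congr1 (fun f : contC R => f x) (walsh_sqr R F).
have [_ -> _ _ [-> _]] := contCE (walsh R F) (walsh R F) 0 x.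
rewrite -expr2 => /eqP; rewrite sqrf_eq1 => /orP[] /eqP ->; by [left|right].
Qed.

Lemma normc_walsh (R : realType) (F : {fset nat}) (x : cantor_space) :
  normc (walsh R F x) = 1.
Proof. by have [->|->] := walsh_pm1 R F x; rewrite ?normcN normc1. Qed.

Lemma supnorm_walsh (R : realType) (F : {fset nat}) : supnorm (walsh R F) = 1.
Proof.
rewrite /supnorm (_ : image _ _ = [set 1]%classic) ?sup1 // eqEsubset.
split=> [_ [x _ <-]|_ ->]; first exact: normc_walsh.
by exists point => //; exact: normc_walsh.
Qed.

Lemma supnorm0 (R : realType) : supnorm (0 : contC R) = 0.
Proof.
rewrite /supnorm (_ : image _ _ = [set 0]%classic) ?sup1 // eqEsubset.
split=> [_ [x _ <-]|_ ->]; first exact: normc0.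
by exists point => //; exact: normc0.
Qed.

Lemma lip_filtration_walsh (R : realType) (lambda : {scalar contC R})
    (m : nat) (F : {fset nat}) :
  is_uniform_state lambda -> m \in F -> (forall j, j \in F -> (j <= m)%N) ->
  lip_filtration lambda (walsh R F) = (2 ^+ (m + 1))%:E.
Proof.
move=> hl mF Fm; apply/eqP; rewrite eq_le; apply/andP; split.
  apply: ge_ereal_sup => _ [n _ <-]; rewrite lee_fin invrK.
  have [nm|mn] := leqP n m.
    rewrite (E_walsh_eq0 _ _ _ _ _ hl mF nm) subr0 supnorm_walsh mul1r.
    by rewrite ler_eXn2l ?ltr1n // leq_add2r.
  rewrite E_walsh_id ?subrr ?supnorm0 ?mul0r ?exprn_ge0 //.
  by move=> j /Fm jm; exact: leq_ltn_trans mn.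
apply: ereal_sup_ubound; exists m => //.
by rewrite (E_walsh_eq0 _ _ _ _ _ hl mF) // subr0 supnorm_walsh mul1r invrK.
Qed.

Lemma normc_walsh_sub (R : realType) (F : {fset nat}) (x y : cantor_space) :
  normc (walsh R F x - walsh R F y) <= 2.
Proof.
apply: le_trans (le_normcD _ _) _.
by rewrite normcN !normc_walsh.
Qed.

Lemma walsh_local (R : realType) (F : {fset nat}) (x y : cantor_space) :
  (forall j, j \in F -> x j = y j) -> walsh R F x = walsh R F y.
Proof.
move=> xy; rewrite /walsh !contC_prod; apply: eq_big_seq => j jF.
by rewrite !u_E xy.
Qed.

Lemma walsh_flip (R : realType) (F : {fset nat}) (m : nat) (x y : cantor_space) :
  m \in F -> x m != y m -> (forall j, j != m -> x j = y j) ->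
  walsh R F x = - walsh R F y.
Proof.
move=> mF xym xy; rewrite /walsh !contC_prod !(big_fsetD1 m mF) /= -mulNr.
congr (_ * _).
  by rewrite !u_E; case: (x m) (y m) xym => [] [] //= _; rewrite opprK.
apply: eq_big_seq => j; rewrite !inE => /andP[jm _].
by rewrite !u_E xy.
Qed.

Lemma lip_dist_walsh (R : realType) (m : nat) (F : {fset nat}) :
  m \in F -> (forall j, j \in F -> (j <= m)%N) ->
  lip_dist (walsh R F) = (2 ^+ (m + 1))%:E.
Proof.
move=> mF Fm; apply/eqP; rewrite eq_le; apply/andP; split.
  apply: ge_ereal_sup => _ [x [y [xy ->]]]; rewrite lee_fin /cantor_dist.
  case: pselect => // {}xy; case: ex_minnP => k _ kmin; rewrite invrK.
  have [km|mk] := leqP k m.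
    rewrite addn1 exprS ler_pM ?exprn_ge0 ?normc_walsh_sub //.
      by rewrite -lecR -normCC normr_ge0.
    by rewrite ler_eXn2l ?ltr1n.
  rewrite (walsh_local _ _ x y) ?subrr ?normc0 ?mul0r ?exprn_ge0 // => j /Fm jm.
  apply/eqP/negPn/negP => /kmin.
  by rewrite leqNgt (leq_ltn_trans jm mk).
apply: ereal_sup_ubound.
pose x : cantor_space := fun=> false.
pose y : cantor_space := fun j => j == m.
have xym : x m != y m by rewrite /x /y eqxx.
exists x, y; split=> [xy|]; first by rewrite xy eqxx in xym.
have xyE : walsh R F x = - walsh R F y.
  by apply: (walsh_flip _ _ m) => // j /negbTE jm; rewrite /y jm.
rewrite xyE.
apply: congr1; rewrite /cantor_dist; case: pselect => [xy|xy].
  by rewrite xy eqxx in xym.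
case: ex_minnP => k xyk kmin.
have -> : k = m by move: xyk; rewrite /x /y; case: (k =P m).
rewrite invrK addn1 exprS; congr (_ * _).
by rewrite -opprD normcN -(mulr2n (walsh R F y : Rcomplex R)) normcMn normc_walsh.
Qed.

Theorem theorem2p3 (R : realType) (lambda : {scalar contC R})
    (hlambda : is_uniform_state lambda) :
  (forall n : nat,
     lip_dist (u_ R n) = (2 ^+ (n + 1))%:E /\
     lip_filtration lambda (u_ R n) = (2 ^+ (n + 1))%:E) /\
  (forall (z : nat) (j : 'I_z.+1 -> nat),
     z <> 0%N ->
     (forall a b : 'I_z.+1, (a < b)%N -> (j a < j b)%N) ->
     lip_dist (\prod_(i < z.+1) u_ R (j i)) = (2 ^+ (j ord_max + 1))%:E /\
     lip_filtration lambda (\prod_(i < z.+1) u_ R (j i)) = (2 ^+ (j ord_max + 1))%:E).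
Proof.
split=> [n|z j _ jlt].
  have -> : u_ R n = walsh R [fset n]%fset by rewrite /walsh big_seq_fset1.
  have nn : n \in [fset n]%fset by rewrite inE.
  have le_n k : k \in [fset n]%fset -> (k <= n)%N by rewrite inE => /eqP ->.
  by split; [exact: lip_dist_walsh|exact: lip_filtration_walsh].
have jinj : injective j.
  move=> a b jab; apply: ord_inj.
  by case: (ltngtP a b) => // /jlt; rewrite jab ltnn.
pose F : {fset nat} := [fset j i | i in 'I_z.+1]%fset.
have -> : \prod_(i < z.+1) u_ R (j i) = walsh R F.
  rewrite /walsh big_imfset /=; last by move=> a b _ _; exact: jinj.
  by rewrite big_enum.
have jF : j ord_max \in F by apply/imfsetP; exists ord_max.
have Fj k : k \in F -> (k <= j ord_max)%N.
  move=> /imfsetP[i _ ->].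
  have [imax|iz] := eqVneq (i : nat) z; last first.
    by apply/ltnW/jlt; rewrite ltn_neqAle iz leq_ord.
  by rewrite (_ : i = ord_max) //; exact: ord_inj.
by split; [exact: lip_dist_walsh|exact: lip_filtration_walsh].
Qed.
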